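(* For every real number $\alpha\in(2,3)$ there exist a dendrite $D$ and a continuous surjective map $f\colon D\to D$ with $h_{\mathrm{pol}}(f)=\alpha$.
   Context: A dendrite is a locally connected continuum (nonempty compact connected metric space) containing no simple closed curve. Polynomial entropy of a continuous selfmap $f$ of a compact metric space $(X,d)$: $S\subseteq X$ is $(n,\varepsilon,f)$-separated if $\max_{0\le i\le n-1}d(f^i(x),f^i(y))>\varepsilon$ for any distinct $x,y\in S$; $\mathrm{sep}(n,\varepsilon,f)$ is the maximal cardinality of an $(n,\varepsilon,f)$-separated subset of $X$; $h_{\mathrm{pol}}(f)=\lim_{\varepsilon\to0}\limsup_{n\to\infty}\frac{\log\mathrm{sep}(n,\varepsilon,f)}{\log n}\in[0,\infty]$. *)

(* Defs.v *)
From HB Require Import structures.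
From mathcomp Require Import all_boot all_order all_algebra.
From mathcomp Require Import all_classical all_reals all_analysis.

Set Implicit Arguments.
Unset Strict Implicit.
Unset Printing Implicit Defensive.

Import Order.TTheory GRing.Theory Num.Theory.
Import numFieldNormedType.Exports.

Local Open Scope classical_set_scope.
Local Open Scope ring_scope.

(* A and B carry their subspace topologies; the values of f outside A and of g
   outside B are irrelevant. *)
Definition homeomorphic (S T : topologicalType) (A : set S) (B : set T) : Prop :=
  exists (f : S -> T) (g : T -> S),
    [/\ {within A, continuous f} /\ {within B, continuous g},
        set_fun A B f, set_fun B A g,
        (forall x, A x -> g (f x) = x) & (forall y, B y -> f (g y) = y)].

Definition unit_circle (R : realType) : set (R * R) :=
  [set p | p.1 ^+ 2 + p.2 ^+ 2 = 1].

Definition simple_closed_curve (R : realType) (T : topologicalType)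
    (C : set T) : Prop :=
  homeomorphic (@unit_circle R) C.

Definition locally_connected (T : topologicalType) : Prop :=
  forall (x : T) (U : set T), nbhs x U ->
    exists V : set T, [/\ open V, connected V, V x & V `<=` U].

Definition continuum (R : realType) (D : metricType R) : Prop :=
  [/\ [set: D] !=set0, compact [set: D] & connected [set: D]].

Definition dendrite (R : realType) (D : metricType R) : Prop :=
  [/\ continuum D, locally_connected D &
      ~ exists C : set D, simple_closed_curve R C].

Section PolynomialEntropy.
Context (R : realType) (X : metricType R).
Implicit Types (f : X -> X) (n : nat) (eps : R) (S : set X).

(* Distances being nonnegative, the default value 0 of the iterated maximum is
   harmless for n > 0. *)
Definition separated_set n eps f S : Prop :=
  forall x y : X, S x -> S y -> x <> y ->
    eps < \big[Num.max/0]_(i < n) mdist (iter i f x) (iter i f y).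

(* On a compact X, for eps > 0 and f continuous, this supremum of cardinalities
   is finite, hence a maximum; counting is +oo on infinite sets. *)
Definition sep n eps f : \bar R :=
  ereal_sup [set counting S | S in separated_set n eps f].

(* The quotient is only meaningful for n > 1, the remaining terms do not affect
   the upper limit. *)
Definition pol_growth f eps : \bar R :=
  limn_esup (fun n => (lne (sep n eps f) / (ln n%:R)%:E)%E).

(* pol_growth f is nonincreasing in eps, so that the limit always exists in
   the extended reals. *)
Definition hpol f : \bar R :=
  lim (pol_growth f eps @[eps --> 0^'+]).

End PolynomialEntropy.

(* Main.v *)
(* The dendrite is a star: countably many arms, the [i]-th of length [2^-i],
   all glued at their foot. The map shifts the arm [i + 3] onto the arm [i],
   folds the arm [0] over the arms [3 b_j + 1], the arm [1] over the arms
   [3 j + 2], and collapses the arm [2] to the foot. An orbit is thus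
   coded by the three waiting times [a], [b_j], [c] before its visits to the
   arms [0], [1], [2]; since [b_j] grows like [j^(1 / (alpha - 2))], about
   [n * n^(alpha - 2) * n] codes fit into [n] steps. The folds accumulate at
   the tips of the arms [0] and [1], so that all these visits are visible at a
   fixed scale. *)

From HB Require Import structures.
Require Import Defs.
From mathcomp Require Import all_boot all_order all_algebra.
From mathcomp Require Import all_classical all_reals all_analysis.
From mathcomp Require Import lra ring zify.

Set Implicit Arguments.
Unset Strict Implicit.
Unset Printing Implicit Defensive.

Import Order.TTheory GRing.Theory Num.Theory.
Import numFieldNormedType.Exports.

Local Open Scope classical_set_scope.
Local Open Scope ring_scope.

(** * The star *)

(** The two bounds on separated sets must have the same exponent. Above: at a fixed scale, [n] steps
    of an orbit are determined by at most three waiting times and three heights rounded to a finite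
    grid. Waits beyond [n] plus a constant are indistinguishable, since the lengths [2^-i] keep such
    orbits near the foot, and the collapse of the arm [2] forbids a fourth wait. The residue of the
    arm index modulo [3] separates the three stages, so no stage can be repeated. Thinning out the
    middle wait alone turns one factor [n] into [n^(alpha - 2)]; orbits that start in a later stage
    contribute only lower order terms.

    The obstacle is continuity: the [j]-th fold has only an interval of length [2^-(j+1)] in which
    to run over a whole arm. Its slope stays bounded because [j <= b j], which holds since
    [1 / (alpha - 2) >= 1]. The shift expands by the constant factor [8] and is already onto, so the
    folds are free to serve the entropy alone. *)

(* The point at height [t] of the [i]-th arm is encoded by the pair [(i, t)],
   the common foot of the arms only by [(0, 0)]. *)
Definition star_mem (R : realType) (p : nat * R) : bool :=
  (0 <= p.2 <= 1) && ((p.2 == 0) ==> (p.1 == 0)%N).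

Record star (R : realType) := Star {
  star_val :> nat * R ;
  star_valP : star_mem star_val }.

HB.instance Definition _ (R : realType) := [isSub for @star_val R].
HB.instance Definition _ (R : realType) := [Choice of star R by <:].

Section StarDistance.
Context {R : realType}.
Implicit Types (x y z : star R) (i : nat).

Definition star_wgt x : R := 2 ^- x.1 * x.2.

(** The path metric: points of different arms are joined through the foot. The foot carries the
    index [0], but its weight is [0], so both branches agree on it. *)
Definition star_dist x y : R :=
  if x.1 == y.1 then `|star_wgt x - star_wgt y| else star_wgt x + star_wgt y.

Lemma exp2V_gt0 i : 0 < 2 ^- i :> R.
Proof. by rewrite invr_gt0 exprn_gt0. Qed.

Lemma exp2V_ge0 i : 0 <= 2 ^- i :> R.
Proof. exact/ltW/exp2V_gt0. Qed.

Lemma star_wgt_ge0 x : 0 <= star_wgt x.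
Proof.
have /andP[/andP[x0 _] _] := star_valP x.
by rewrite /star_wgt mulr_ge0// ltW// exp2V_gt0.
Qed.

Lemma star_distxx x : star_dist x x = 0.
Proof. by rewrite /star_dist eqxx subrr normr0. Qed.

(** On different indices both weights vanish, and the uniqueness of the code [(0, 0)] imposed by
    [star_mem] contradicts the difference of the indices. *)
Lemma star_dist_eq0 x y : star_dist x y = 0 -> x = y.
Proof.
rewrite /star_dist; case: eqVneq => [xy|xy] h; apply: val_inj => /=.
  move/normr0_eq0/eqP: h; rewrite subr_eq0 /star_wgt xy => /eqP.
  move/(mulfI (lt0r_neq0 (exp2V_gt0 _))).
  by case: x y xy => -[i t] ? [[j s] ?] /= -> ->.
have [x0 y0] : star_wgt x = 0 /\ star_wgt y = 0.
  by have := star_wgt_ge0 x; have := star_wgt_ge0 y; split; move: h; lra.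
have foot z : star_wgt z = 0 -> z.2 = 0 /\ z.1 = 0%N.
  move/eqP; rewrite mulf_eq0 gt_eqF ?exp2V_gt0//= => /eqP z0; split=> //.
  by have /andP[_] := star_valP z; rewrite z0 eqxx => /eqP.
by move: xy; rewrite (foot _ x0).2 (foot _ y0).2.
Qed.

Lemma star_dist_sym x y : star_dist x y = star_dist y x.
Proof.
rewrite /star_dist eq_sym distrC; case: ifP => // _; exact: addrC.
Qed.

Lemma star_dist_triangle y x z :
  star_dist x z <= star_dist x y + star_dist y z.
Proof.
have := star_wgt_ge0 x; have := star_wgt_ge0 y; have := star_wgt_ge0 z.
rewrite /star_dist.
move: (star_wgt x) (star_wgt y) (star_wgt z) => a b c c0 b0 a0.
have [->|xy] := eqVneq x.1 y.1; have [yz|yz] := eqVneq y.1 z.1.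
- by rewrite (le_trans _ (ler_normD _ _))// subrKA.
- by have := ler_norm (a - b); lra.
- by move: xy; rewrite yz => /negbTE ->; have := ler_norm (c - b);
    rewrite distrC; lra.
- case: ifP => _; last by lra.
  by rewrite ler_norml; lra.
Qed.

End StarDistance.

HB.instance Definition _ (R : realType) := @isMetric.Build R (star R)
  star_dist star_distxx star_dist_eq0 star_dist_sym star_dist_triangle.

Section StarMetric.
Context {R : realType}.
Implicit Types (x y z : star R) (i j : nat) (t s : R).

Fact star_mem0 : star_mem (0%N, 0 : R).
Proof. by rewrite /star_mem /= lexx ler01 eqxx. Qed.

Definition star0 : star R := Star star_mem0.

(* Junk value: [star0] for [t] outside [[0, 1]]. *)
Definition pt i t : star R := insubd star0 (i, t).

Lemma pt_le0 i t : t <= 0 -> pt i t = star0.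
Proof.
move=> t0; apply: val_inj; rewrite val_insubd /star_mem /=.
by case: ifP => // /andP[/andP[t0' _]]; have -> : t = 0 by [lra|];
  rewrite eqxx => /eqP ->.
Qed.

Lemma pt0 i : pt i 0 = star0. Proof. exact: pt_le0. Qed.

Lemma val_pt i t : 0 < t <= 1 -> val (pt i t) = (i, t).
Proof.
by move=> /andP[t0 t1]; rewrite val_insubd /star_mem /= ltW// t1 gt_eqF.
Qed.

Lemma starP x : exists i t, 0 <= t <= 1 /\ x = pt i t.
Proof.
exists x.1, x.2; case: x => -[i t] xP; split; first by case/andP: (xP).
by apply: val_inj; rewrite val_insubd [star_mem _]xP.
Qed.

Lemma star_wgt_pt i t : 0 <= t <= 1 -> star_wgt (pt i t) = 2 ^- i * t.
Proof.
move=> /andP[]; rewrite le_eqVlt => /orP[/eqP <- _|t0 t1].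
  by rewrite pt0 /star_wgt !mulr0.
by rewrite /star_wgt [star_val _]val_pt ?t0.
Qed.

Lemma mdist_pt i t s : 0 <= t <= 1 -> 0 <= s <= 1 ->
  mdist (pt i t) (pt i s) = 2 ^- i * `|t - s|.
Proof.
move=> ht hs; change (star_dist (pt i t) (pt i s) = 2 ^- i * `|t - s|).
rewrite /star_dist !star_wgt_pt// -mulrBr normrM (gtr0_norm (exp2V_gt0 _)).
(* Height [0] is a separate case because [pt i 0] carries the index [0] instead of [i]. *)
have [t0|t0] := eqVneq t 0; first rewrite t0 pt0 mulr0 !add0r normrN.
  have -> : `|s| = s by rewrite ger0_norm//; case/andP: hs.
  by case: ifP => // _; rewrite mulr0 add0r.
have [s0|s0] := eqVneq s 0.
  rewrite s0 mulr0 addr0 subr0; have -> : `|t| = t.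
    by rewrite ger0_norm//; case/andP: ht.
  by case: ifP.
by rewrite ![star_val _]val_pt ?eqxx// lt_neqAle eq_sym ?s0 ?t0.
Qed.

Lemma mdist_pt_neq i j t s : 0 <= t <= 1 -> 0 <= s <= 1 -> i != j ->
  mdist (pt i t) (pt j s) = 2 ^- i * t + 2 ^- j * s.
Proof.
move=> ht hs ij; change (star_dist (pt i t) (pt j s) = 2 ^- i * t + 2 ^- j * s).
rewrite /star_dist !star_wgt_pt//.
have [t0|t0] := eqVneq t 0.
  case: ifP => // _; rewrite t0 mulr0 sub0r normrN add0r ger0_norm//.
  by apply: mulr_ge0; [exact: exp2V_ge0|case/andP: hs].
have [s0|s0] := eqVneq s 0.
  case: ifP => // _; rewrite s0 mulr0 addr0 subr0 ger0_norm//.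
  by apply: mulr_ge0; [exact: exp2V_ge0|case/andP: ht].
by rewrite ![star_val _]val_pt/= ?(negbTE ij)// lt_neqAle eq_sym ?s0 ?t0.
Qed.

Lemma mdist_star0 i t : 0 <= t <= 1 -> mdist star0 (pt i t) = 2 ^- i * t.
Proof.
move=> ht; rewrite -(pt0 i) mdist_pt ?lexx ?ler01// sub0r normrN.
by rewrite ger0_norm//; case/andP: ht.
Qed.

Lemma mdist_pt_le i j t s : 0 <= t <= 1 -> 0 <= s <= 1 ->
  mdist (pt i t) (pt j s) <= 2 ^- i * t + 2 ^- j * s.
Proof.
move=> ht hs; rewrite -!mdist_star0// [X in _ <= X + _]metric_sym.
exact: metric_triangle.
Qed.

End StarMetric.

Section MetricSpace.
Context {R : realType} {M : metricType R}.

Lemma nbhs_mdist (x : M) (A : set M) :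
  nbhs x A <-> exists2 e : R, 0 < e & forall y, mdist x y < e -> A y.
Proof. exact: metricType_numDomainType.nbhs_mdistP. Qed.

Lemma open_mdist_ball (x : M) (e : R) : open [set y | mdist x y < e].
Proof.
rewrite openE => y /= xy; apply/nbhs_mdist.
exists (e - mdist x y) => /=; first by rewrite subr_gt0.
by move=> z /= yz; rewrite (le_lt_trans (metric_triangle _ y _))//; lra.
Qed.

Lemma mdist_continuous (o : M) : continuous (fun x => mdist x o : R).
Proof.
move=> x; apply/cvgrPdist_lt => e e0; apply/nbhs_mdist; exists e => //= y xy.
rewrite (le_lt_trans _ xy)// ler_norml.
have := metric_triangle x y o; have := metric_triangle y x o.
by rewrite (metric_sym y x); lra.
Qed.

Lemma lipschitz_continuous_mdist (N : metricType R) (k : R) (f : M -> N) :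
  0 < k -> (forall x y, mdist (f x) (f y) <= k * mdist x y) -> continuous f.
Proof.
move=> k0 kf x; apply/metricType_numDomainType.cvgrPdist_lt => e e0.
apply/nbhs_mdist; exists (e / k) => /=; first by rewrite divr_gt0.
by move=> y /= xy; rewrite (le_lt_trans (kf _ _))// mulrC -ltr_pdivlMr.
Qed.

End MetricSpace.

(** * Topology of the star *)

Section StarTopology.
Context {R : realType}.
Implicit Types (x y z : star R) (i j : nat) (t s : R).

Lemma exp2V_le1 i : 2 ^- i <= 1 :> R.
Proof. by rewrite invf_le1 ?exprn_gt0// exprn_ege1// ler1n. Qed.

Lemma exp2V_cvg0 (e : R) : 0 < e ->
  exists N, forall i, (N <= i)%N -> 2 ^- i < e.
Proof.
move=> e0; have : `|2^-1 : R| < 1 by rewrite ger0_norm//; lra.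
move=> /cvg_expr /cvgrPdist_lt /(_ _ e0)[N _ hN].
by exists N => i /hN /=; rewrite sub0r normrN exprVn gtr0_norm ?exp2V_gt0.
Qed.

Lemma pt_continuous i : {within `[0, 1], continuous (pt i : R -> star R)}.
Proof.
apply/subspace_continuousP => t /=; rewrite in_itv/= => ht.
apply/metricType_numDomainType.cvgrPdist_lt => e e0.
rewrite near_withinE; apply: filterS (nbhsx_ballx t e e0) => s ts.
rewrite /= in_itv /= => hs; rewrite mdist_pt// (le_lt_trans _ ts)//.
by rewrite ler_piMl// exp2V_le1.
Qed.

Lemma connected_pt i (J : set R) : is_interval J ->
  J `<=` `[0, 1] -> connected (pt i @` J).
Proof.
move=> iJ J01; apply: connected_continuous_connected.
  exact/connected_intervalP.
exact: continuous_subspaceW (@pt_continuous i).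
Qed.

(** The ball is a union of initial segments of the arms, which all share the foot. *)
Lemma connected_star_foot (e : R) :
  connected [set y | mdist (@star0 R) y < e].
Proof.
have -> : [set y | mdist star0 y < e] = \bigcup_(i in [set: nat])
    (pt i @` [set t : R | 0 <= t <= 1 /\ 2 ^- i * t < e]).
  apply/seteqP; split=> [y /= |_ [i _ /= [t [ht ti] <-]] /=]; last first.
    by rewrite mdist_star0.
  have [i [t [ht ->]]] := starP y; rewrite mdist_star0// => ti.
  by exists i => //; exists t.
have [e0|e0] := leP e 0.
  rewrite bigcup0; first exact: connected0.
  move=> i _; apply/seteqP; split => // y [t [/andP[t0 _] ti] _].
  by move: ti; apply/negP; rewrite -leNgt (le_trans e0)// mulr_ge0 ?exp2V_ge0.
apply: bigcup_connected.
  by exists star0 => i _; exists 0; rewrite ?pt0//= mulr0 lexx ler01.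
move=> i _; apply: connected_pt => [t s /= [/andP[t0 _] _] [/andP[_ s1] si] u|].
  move=> /andP[tu us]; split; first by rewrite (le_trans t0)// (le_trans us).
  by rewrite (le_lt_trans _ si)// ler_wpM2l// exp2V_ge0.
by move=> t /= [ht _]; rewrite in_itv.
Qed.

(** A radius not exceeding the distance to the foot keeps the ball inside one arm, where it is the
    image of an interval. *)
Lemma connected_star_ball i t (e : R) : 0 < t <= 1 -> e <= 2 ^- i * t ->
  connected [set y | mdist (pt i t) y < e].
Proof.
move=> /andP[t0 t1] et; have ht : 0 <= t <= 1 by rewrite ltW.
have -> : [set y | mdist (pt i t) y < e] =
    pt i @` [set s : R | 0 <= s <= 1 /\ 2 ^- i * `|t - s| < e].
  apply/seteqP; split=> [y /= |_ [/= s [hs si] <-]] /=; last first.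
    by rewrite mdist_pt.
  have [j [s [hs ->]]] := starP y.
  have [->|ij] := eqVneq i j; first by rewrite mdist_pt// => si; exists s.
  rewrite mdist_pt_neq// => ts; move: (lt_le_trans ts et).
  by rewrite gtrDl pmulr_rlt0 ?exp2V_gt0// ltNge; case/andP: hs => ->.
apply: connected_pt => [a b /= [/andP[a0 _] ai] [/andP[_ b1] bi] u|].
  move=> /andP[au ub]; split; first by rewrite (le_trans a0)// (le_trans ub).
  move: ai bi; rewrite ![2 ^- i * _]mulrC -!ltr_pdivlMr ?exp2V_gt0//.
  by rewrite !ltr_norml; lra.
by move=> s /= [hs _]; rewrite in_itv.
Qed.

Lemma star_locally_connected : locally_connected (star R).
Proof.
move=> x U /nbhs_mdist[e /= e0 eU].
have [i [t [ht xE]]] := starP x.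
have [t0|t0] := eqVneq t 0.
  exists [set y | mdist x y < e]; split => //=; rewrite ?mdistxx//.
    exact: open_mdist_ball.
  by rewrite xE t0 pt0; exact: connected_star_foot.
have {}t0 : 0 < t by rewrite lt_neqAle eq_sym t0; case/andP: ht.
exists [set y | mdist x y < Num.min e (2 ^- i * t)]; split => /=.
- exact: open_mdist_ball.
- rewrite xE; apply: connected_star_ball; last by rewrite ge_min lexx orbT.
  by rewrite t0; case/andP: ht.
- by rewrite mdistxx lt_min e0 mulr_gt0// exp2V_gt0.
- by move=> y /= xy; apply: eU => /=; rewrite (lt_le_trans xy)// ge_min lexx.
Qed.

Lemma star_connected : connected [set: star R].
Proof.
have -> : [set: star R] = [set y | mdist (@star0 R) y < 2].
  apply/seteqP; split => // y _ /=; have [i [t [ht ->]]] := starP y.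
  rewrite mdist_star0// (@le_lt_trans _ _ 1) ?ltr1n//.
  by case/andP: ht => t0 t1; rewrite mulr_ile1// ?exp2V_le1// exp2V_ge0.
exact: connected_star_foot.
Qed.

(* Away from any neighbourhood of the foot only finitely many arms remain. *)
Lemma star_compact : compact [set: star R].
Proof.
move=> F PF _; apply: contrapT => nF.
have : ~ cluster F (@star0 R) by move=> h; apply: nF; exists star0.
rewrite clusterE => /existsNP[A] /not_implyP[FA].
move=> /existsNP[B] /not_implyP[/nbhs_mdist[e /= e0 eB]].
move=> /set0P/negP/negPn/eqP AB0.
have [N hN] := exp2V_cvg0 e0.
pose K := \big[setU/set0]_(i < N) (pt i @` `[(0:R), 1]) : set (star R).
have cK : compact K.
  apply: bigsetU_compact => i _; apply: continuous_compact.
    exact: pt_continuous.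
  exact: segment_compact.
have FK : F K.
  apply: filterS FA => x Ax; have [i [t [ht xE]]] := starP x.
  rewrite /K -(bigcup_mkord N (fun i => pt i @` `[(0 : R), 1])).
  exists i => /=; last first.
    by exists t => //=; rewrite in_itv.
  rewrite ltnNge; apply/negP => Ni.
  suff : (A `&` B) x by rewrite AB0.
  split => //; apply: eB => /=; rewrite xE mdist_star0//.
  rewrite (le_lt_trans _ (hN _ Ni))// ler_piMr ?exp2V_ge0//.
  by case/andP: ht.
by have [x [_ Fx]] := cK F PF FK; apply: nF; exists x.
Qed.

End StarTopology.

(** * Circles *)

Lemma continuous_hits (R : realType) (u : R -> R) (a b v : R) :
  continuous u -> u a < v < u b -> exists s, u s = v.
Proof.
move=> cu /andP[av vb].
have [ab|ba] := leP a b.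
  have [||s _ us] := @IVT R u a b v ab; last by exists s.
    exact: continuous_subspaceT.
  by rewrite ge_min le_max (ltW av) (ltW vb) orbT.
have [||s _ us] := @IVT R u b a v (ltW ba); last by exists s.
  exact: continuous_subspaceT.
by rewrite ge_min le_max (ltW av) (ltW vb) orbT.
Qed.

Section Circle.
Context {R : realType}.
Implicit Types (z p q : R * R) (s : R).

(* Inverse stereographic projection from [z]: a parametrization by the line of
   the circle deprived of [z]. *)
Definition circle_chart z s : R * R :=
  let c := (s ^+ 2 - 1) / (s ^+ 2 + 1) in
  let d := 2 * s / (s ^+ 2 + 1) in
  (z.1 * c - z.2 * d, z.1 * d + z.2 * c).

Lemma sqrD1_neq0 s : s ^+ 2 + 1 != 0.
Proof. by rewrite gt_eqF// ltr_wpDl// sqr_ge0. Qed.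

Lemma circle_chart_continuous z : continuous (circle_chart z).
Proof.
have cV : continuous (fun s : R => (s ^+ 2 + 1)^-1).
  move=> s; apply: cvgV; first exact: sqrD1_neq0.
  by apply: cvgD; [exact: exprn_continuous|exact: cvg_cst].
have cc : continuous (fun s : R => (s ^+ 2 - 1) / (s ^+ 2 + 1)).
  move=> s; apply: cvgM; last exact: cV.
  by apply: cvgB; [exact: exprn_continuous|exact: cvg_cst].
have cd : continuous (fun s : R => 2 * s / (s ^+ 2 + 1)).
  move=> s; apply: cvgM; last exact: cV.
  by apply: cvgM; [exact: cvg_cst|exact: cvg_id].
move=> s.
have c1 : {for s, continuous (fun s => (circle_chart z s).1)}.
  by apply: cvgB; apply: cvgM; (try exact: cvg_cst); [exact: cc|exact: cd].
have c2 : {for s, continuous (fun s => (circle_chart z s).2)}.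
  by apply: cvgD; apply: cvgM; (try exact: cvg_cst); [exact: cd|exact: cc].
exact: (cvg_pair c1 c2).
Qed.

Lemma circle_chart_mem z s : unit_circle z -> unit_circle (circle_chart z s).
Proof.
rewrite /unit_circle /circle_chart /= => hz.
have h := sqrD1_neq0 s.
transitivity ((z.1 ^+ 2 + z.2 ^+ 2) *
  (((s ^+ 2 - 1) / (s ^+ 2 + 1)) ^+ 2 + (2 * s / (s ^+ 2 + 1)) ^+ 2)).
  by ring.
by rewrite hz mul1r; field.
Qed.

(** In complex notation the chart is [z * (c + i d)]; equality with [z] would force [c = 1], whereas
    the numerator of [c] is smaller than its denominator. *)
Lemma circle_chart_neq z s : unit_circle z -> circle_chart z s <> z.
Proof.
case: z => a b; rewrite /unit_circle /circle_chart /= => hz [].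
have h := sqrD1_neq0 s.
set c := (_ / _); set d := (_ / _) => h1 h2.
have c1 : c - 1 = 0.
  transitivity ((c - 1) * (a ^+ 2 + b ^+ 2)); first by rewrite hz mulr1.
  transitivity (a * (a * c - b * d) + b * (a * d + b * c) -
    (a ^+ 2 + b ^+ 2)); first by ring.
  by rewrite h1 h2; ring.
have := congr1 (fun r => r * (s ^+ 2 + 1)) c1.
by rewrite /= /c mulrBl mulfVK// mul1r mul0r; lra.
Qed.

Lemma circle_chart_surj z p : unit_circle z -> unit_circle p -> p <> z ->
  exists s, circle_chart z s = p.
Proof.
case: z p => a b [x y]; rewrite /unit_circle /circle_chart /= => hz hp pz.
have h1 : 1 - (a * x + b * y) != 0.
  apply/eqP => h; apply: pz; have : (x - a) ^+ 2 + (y - b) ^+ 2 = 0.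
    transitivity ((x ^+ 2 + y ^+ 2) + (a ^+ 2 + b ^+ 2) - 2 * (a * x + b * y)).
      by ring.
    by rewrite hz hp; lra.
  move/eqP; rewrite paddr_eq0 ?sqr_ge0// !sqrf_eq0 !subr_eq0.
  by move=> /andP[/eqP -> /eqP ->].
(* The scalar product [C] and the determinant [S] of [z] and [p] are the cosine and sine of the
   angle from [z] to [p]; [S / (1 - C)] is the stereographic projection of [(C, S)] from
   [(1, 0)]. *)
exists ((a * y - b * x) / (1 - (a * x + b * y))).
have e1 : (a * y - b * x) ^+ 2 = 1 - (a * x + b * y) ^+ 2.
  rewrite -[1]mulr1 -{1}hz -hp; ring.
set C := a * x + b * y in h1 e1 *; set S := a * y - b * x in e1 *.
have h2 : 1 + C != 0 \/ 1 + C = 0 by case: (eqVneq (1 + C) 0); [right|left].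
have e2 : (S / (1 - C)) ^+ 2 + 1 = 2 / (1 - C).
  by rewrite expr_div_n e1; field.
have e3 : ((S / (1 - C)) ^+ 2 - 1) / ((S / (1 - C)) ^+ 2 + 1) = C.
  by rewrite e2 expr_div_n e1; field.
have e4 : 2 * (S / (1 - C)) / ((S / (1 - C)) ^+ 2 + 1) = S.
  by rewrite e2; field.
rewrite e3 e4 /C /S; congr pair.
  by transitivity (x * (a ^+ 2 + b ^+ 2)); [ring|rewrite hz mulr1].
by transitivity (y * (a ^+ 2 + b ^+ 2)); [ring|rewrite hz mulr1].
Qed.

(** The circle without [z] is a line, so the intermediate value theorem applies there. *)
Lemma circle_hits_off (u : R * R -> R) z p q (v : R) :
  {within @unit_circle R, continuous u} ->
  unit_circle z -> unit_circle p -> unit_circle q -> p <> z -> q <> z ->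
  u p < v < u q -> exists z', [/\ unit_circle z', z' <> z & u z' = v].
Proof.
move=> cu hz hp hq pz qz; have [a ap] := circle_chart_surj hz hp pz.
have [b bq] := circle_chart_surj hz hq qz; rewrite -ap -bq.
have cuc : continuous (u \o circle_chart z).
  move=> s U /= nU; have cs := circle_chart_mem s hz.
  have /subspace_continuousP /(_ _ cs _ nU) cuU := cu.
  apply: (@filterS _ (nbhs s) _ _ _ _ (@circle_chart_continuous z s _ cuU)).
  by move=> r; apply; exact: circle_chart_mem.
move=> /(continuous_hits cuc)[s us]; exists (circle_chart z s).
by split => //; [exact: circle_chart_mem|exact: circle_chart_neq].
Qed.

Lemma circle_hits_twice (u : R * R -> R) p q (v : R) :
  {within @unit_circle R, continuous u} ->
  unit_circle p -> unit_circle q -> u p < v < u q ->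
  exists z z', [/\ unit_circle z, unit_circle z', z <> z', u z = v & u z' = v].
Proof.
move=> cu hp hq pvq.
(* A first puncture away from [p] and [q], found among three points. It yields one solution [z], and
   a second puncture at [z] yields another. *)
have [w [hw pw qw]] : exists w : R * R, [/\ unit_circle w, p <> w & q <> w].
  have c1 : unit_circle (1, 0 : R) by rewrite /unit_circle /=; ring.
  have c2 : unit_circle (-1, 0 : R) by rewrite /unit_circle /=; ring.
  have c3 : unit_circle (0, 1 : R) by rewrite /unit_circle /=; ring.
  have n12 : (1, 0) <> (-1, 0) :> R * R by case; lra.
  have n13 : (1, 0) <> (0, 1) :> R * R by case; lra.
  have n23 : (-1, 0) <> (0, 1) :> R * R by case; lra.
  have [p1|p1] := pselect (p = (1, 0)); have [q1|q1] := pselect (q = (1, 0)).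
  - by exists (0, 1); rewrite p1 q1.
  - have [q2|q2] := pselect (q = (-1, 0)); last by exists (-1, 0); rewrite p1.
    by exists (0, 1); rewrite p1 q2.
  - have [p2|p2] := pselect (p = (-1, 0)); last by exists (-1, 0); rewrite q1.
    by exists (0, 1); rewrite q1 p2.
  - by exists (1, 0).
have [z [hz _ uz]] := circle_hits_off cu hw hp hq pw qw pvq.
have pz : p <> z by move=> pz; move: pvq; rewrite pz uz ltxx.
have qz : q <> z by move=> qz; move: pvq; rewrite qz uz ltxx andbF.
have [z' [hz' zz' uz']] := circle_hits_off cu hz hp hq pz qz pvq.
by exists z, z'; split => // /esym.
Qed.

End Circle.

Section NoCircle.
Context {R : realType}.

(** Every other arm is at distance at least [2^-i] from the tip, and on the arm [i] the distance to
    the tip determines the height. *)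
Lemma mdist_tip_inj i (x y : star R) : 
  mdist x (pt i 1) < 2 ^- i -> mdist x (pt i 1) = mdist y (pt i 1) -> x = y.
Proof.
have tip01 : 0 <= (1 : R) <= 1 by rewrite ler01 lexx.
have onarm z : mdist z (pt i 1) < 2 ^- i -> 
    exists t : R, 0 <= t <= 1 /\ z = pt i t.
  have [j [t [ht ->]]] := starP z.
  have [->|ji] := eqVneq j i; first by exists t.
  rewrite mdist_pt_neq// mulr1 gtrDr ltNge mulr_ge0 ?exp2V_ge0//.
  by case/andP: ht.
move=> xi xy; have [t [ht xE]] := onarm _ xi; rewrite xy in xi.
have [s [hs yE]] := onarm _ xi; move: xy; rewrite xE yE !mdist_pt//.
move/(mulfI (lt0r_neq0 (exp2V_gt0 _))).
move: ht hs => /andP[t0 t1] /andP[s0 s1].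
rewrite !(distrC _ 1) !ger0_norm ?subr_ge0// => ts.
by congr pt; lra.
Qed.

(* On a circle the distance to the tip of an arm takes its intermediate values
   at least twice, but small spheres around a tip are singletons. *)
Lemma star_no_circle : ~ exists C : set (star R), simple_closed_curve R C.
Proof.
move=> [C [f [g [[cf _] _ _ gf _]]]].
pose a : R * R := (1, 0); pose b : R * R := (-1, 0).
have ca : unit_circle a by rewrite /unit_circle /=; ring.
have cb : unit_circle b by rewrite /unit_circle /=; ring.
have finj p q : unit_circle p -> unit_circle q -> f p = f q -> p = q.
  by move=> hp hq pq; rewrite -(gf _ hp) -(gf _ hq) pq.
have ab : f a <> f b.
  by move=> /(finj _ _ ca cb)[]; lra.
(* A point off the foot is closer than [2^-i] to the tip of its arm, as [mdist_tip_inj] demands. *)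
have [p [q [cp cq pq p0]]] : exists p q : R * R,
    [/\ unit_circle p, unit_circle q, f p <> f q & f p <> star0].
  have [a0|a0] := pselect (f a = star0); last by exists a, b.
  by exists b, a; split => //; [exact/nesym|rewrite -a0; exact/nesym].
have [i [t [ht pE]]] := starP (f p).
pose u z := mdist (f z) (pt i 1) : R.
have cu : {within @unit_circle R, continuous u}.
  move=> z; apply: (@continuous_comp (subspace _) _ _ f
    (fun x => mdist x (pt i 1) : R)).
    exact: cf.
  exact: mdist_continuous.
have up : u p < 2 ^- i.
  rewrite /u pE mdist_pt ?ler01 ?lexx// -[ltRHS]mulr1 ltr_pM2l ?exp2V_gt0//.
  have t0 : t != 0 by apply/eqP => t0; apply: p0; rewrite pE t0 pt0.
  move: ht => /andP[]; rewrite le_eqVlt eq_sym (negbTE t0)/= => t0' t1.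
  by rewrite distrC ger0_norm ?subr_ge0//; lra.
have upq : u p != u q by apply/eqP => /(mdist_tip_inj up).
suff [v [vi]] : exists v, v < 2 ^- i /\ (u p < v < u q \/ u q < v < u p).
  have single z z' : unit_circle z -> unit_circle z' ->
      u z = v -> u z' = v -> z = z'.
    move=> hz hz' uz uz'; apply: finj => //; apply: (@mdist_tip_inj i).
      by rewrite -/(u z) uz.
    by rewrite -/(u z) -/(u z') uz.
  by move=> [] h; [have := circle_hits_twice cu cp cq h
                  |have := circle_hits_twice cu cq cp h];
    move=> [z [z' [hz hz' zz' uz uz']]]; exact/zz'/single.
move: upq; rewrite neq_lt => /orP[h|h].
  pose m := Num.min (u q) (2 ^- i).
  have um : u p < m by rewrite lt_min h.
  have mq : m <= u q by rewrite ge_min lexx.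
  have mi : m <= 2 ^- i by rewrite ge_min lexx orbT.
  by exists ((u p + m) / 2); split; [|left]; lra.
by exists ((u p + u q) / 2); split; [|right]; lra.
Qed.

Lemma star_dendrite : dendrite (star R).
Proof.
split; [split| |exact: star_no_circle].
- by exists star0.
- exact: star_compact.
- exact: star_connected.
- exact: star_locally_connected.
Qed.

End NoCircle.

(** * The map *)

Section FoldingMap.
Context {R : realType}.
Implicit Types (x y : star R) (i j k : nat) (t s u v : R).

Definition dyadic_piece u : nat := trunc_log 2 (Num.truncn u^-1).

(** Truncating [u^-1] before taking the logarithm is harmless because the powers of [2] are
    integers. *)
Lemma dyadic_pieceP u : 0 < u <= 1 ->
  2 ^- (dyadic_piece u).+1 < u <= 2 ^- dyadic_piece u.
Proof.
move=> /andP[u0 u1]; have ui0 : 0 <= u^-1 by rewrite invr_ge0 ltW.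
have m0 : (0 < Num.truncn u^-1)%N by rewrite truncn_gt0 invf_ge1.
have /andP[lo hi] := truncn_itv ui0.
have /andP[lo' hi'] := trunc_log_bounds (leqnn 2) m0.
rewrite /dyadic_piece; set j := trunc_log _ _ in lo' hi' *.
rewrite -[u in _ < u <= _]invrK ltf_pV2 ?lef_pV2 ?posrE ?invr_gt0 ?exprn_gt0//.
rewrite -!natrX; apply/andP; split.
  by rewrite (lt_le_trans hi)// ler_nat.
by rewrite (le_trans _ lo)// ler_nat.
Qed.

Lemma exp2V_lt i j : (2 ^- i < 2 ^- j :> R) = (j < i)%N.
Proof. by rewrite ltf_pV2 ?posrE ?exprn_gt0// ltr_eXn2l// ltr1n. Qed.

Lemma exp2V_le i j : (2 ^- i <= 2 ^- j :> R) = (j <= i)%N.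
Proof. by rewrite leNgt exp2V_lt -leqNgt. Qed.

Lemma dyadic_pieceE u j : 2 ^- j.+1 < u <= 2 ^- j -> dyadic_piece u = j.
Proof.
move=> /andP[lo hi]; have u0 : 0 < u by rewrite (lt_trans _ lo) ?exp2V_gt0.
have u1 : u <= 1 by rewrite (le_trans hi) ?exp2V_le1.
have /andP[lo' hi'] : 2 ^- (dyadic_piece u).+1 < u <= 2 ^- dyadic_piece u.
  by apply: dyadic_pieceP; rewrite u0.
have := lt_le_trans lo hi'; have := lt_le_trans lo' hi.
by rewrite !exp2V_lt; lia.
Qed.

(* As [u] runs through the dyadic interval [[2^-(j+1), 2^-j]], [fold g u] runs
   up and down the arm [g j]. *)
Definition fold_height u : R := 1 - `|2 ^+ (dyadic_piece u).+2 * u - 3|.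

Definition fold (g : nat -> nat) u : star R :=
  pt (g (dyadic_piece u)) (fold_height u).

Lemma exp2V_K j : 2 ^+ j * 2 ^- j = 1 :> R.
Proof. by rewrite mulfV// expf_neq0. Qed.

(** The tent lies below the lines of slope [4] (after scaling) from either end of its dyadic
    interval. This controls [fold] across different pieces. *)
Lemma fold_height_bounds u (j := dyadic_piece u) : 0 < u <= 1 ->
  [/\ 0 <= fold_height u <= 1, 2 ^- j * fold_height u <= 4 * (2 ^- j - u)
    & 2 ^- j * fold_height u <= 4 * (u - 2 ^- j.+1)].
Proof.
move=> hu; have := dyadic_pieceP hu.
rewrite /fold_height -/j !exprS invfM.
move: j => j.
have jK := exp2V_K j; have j0 := exp2V_gt0 (R := R) j; have := j0.
rewrite invr_gt0 => p0; move: p0 jK j0; set p := 2 ^+ j; set q := p^-1.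
move=> p0 pq q0 /andP[lo hi].
have -> : 2 * (2 * p) * u = 4 * (p * u) by ring.
have -> : u = q * (p * u) by rewrite mulrA [q * p]mulrC pq mul1r.
(* Rescaling by [2^j] moves every piece to [(1/2, 1]], where the tent is [1 - |4 w - 3|]. *)
set w := p * u; have {lo hi} [lo hi] : 2^-1 < w /\ w <= 1.
  split; first by rewrite -(ltr_pM2l q0) /w mulrA [q * p]mulrC pq mul1r mulrC.
  by rewrite -(ler_pM2l q0) /w mulrA [q * p]mulrC pq mul1r mulr1.
have -> : p * (q * w) = w by rewrite mulrA pq mul1r.
have -> : 4 * (q - q * w) = q * (4 * (1 - w)) by ring.
have -> : 4 * (q * w - 2^-1 * q) = q * (4 * (w - 2^-1)) by ring.
rewrite !(ler_pM2l q0).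
by case: (ger0P (4 * w - 3)) => hw;
  (split; [apply/andP; split| | ]); lra.
Qed.

Lemma fold_le0 g u : u <= 0 -> fold g u = star0.
Proof.
move=> u0; apply: pt_le0; rewrite /fold_height subr_le0.
have : 2 ^+ (dyadic_piece u).+2 * u <= 0.
  by rewrite mulr_ge0_le0// exprn_ge0.
by set w := _ * u => w0; rewrite ler0_norm; lra.
Qed.

Lemma fold1 g : fold g 1 = star0.
Proof.
have j0 : dyadic_piece 1 = 0%N.
  by apply: dyadic_pieceE; rewrite expr1 expr0; lra.
by apply: pt_le0; rewrite /fold_height j0 mulr1 ger0_norm; lra.
Qed.

(** The preimage is taken on the rising half of the tent, where the height is [2^(j+2) u - 2]. *)
Lemma fold_hit g j t : 0 < t <= 1 -> fold g ((2 + t) * 2 ^- j.+2) = pt (g j) t.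
Proof.
move=> /andP[t0 t1]; set u := _ * _.
have j0 := exp2V_gt0 (R := R) j.
have uj : dyadic_piece u = j.
  apply: dyadic_pieceE; rewrite /u !exprS !invfM; set q := 2 ^- j in j0 *.
  have -> : (2 + t) * (2^-1 * (2^-1 * q)) = q * ((2 + t) / 4) by field.
  rewrite [2^-1 * q]mulrC ltr_pM2l// -[X in _ <= X]mulr1 ler_pM2l//.
  by apply/andP; split; lra.
rewrite /fold /fold_height uj /u mulrCA exp2V_K mulr1; congr pt.
by rewrite ler0_norm; lra.
Qed.

(** Within a piece the tent has slope [4 * 2^j], and the arm [g j] has length at most [2^-j].
    Between different pieces the path through the foot is estimated by [fold_height_bounds] at the
    endpoints of dyadic intervals that lie between [u] and [v]. *)
Lemma fold_lipschitz g u v : (forall j, (j <= g j)%N) ->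
  0 <= u <= 1 -> 0 <= v <= 1 -> mdist (fold g u) (fold g v) <= 4 * `|u - v|.
Proof.
move=> gj; wlog uv : u v / u < v => [hw|].
  move=> hu hv; have [uv|uv|->] := ltgtP u v; first exact: hw.
    by rewrite metric_sym distrC; exact: hw.
  by rewrite mdistxx mulr_ge0.
move=> /andP[u0 u1] /andP[v0 v1]; rewrite ltr0_norm ?subr_lt0// opprB.
have hv : 0 < v <= 1 by rewrite v1 (le_lt_trans u0).
have gle j t : 0 <= t -> 2 ^- g j * t <= 2 ^- j * t.
  by move=> t0; rewrite ler_wpM2r// exp2V_le.
have [v01 _ vlo] := fold_height_bounds hv.
have := gle (dyadic_piece v) _ (andP v01).1.
move: u0; rewrite le_eqVlt => /orP[/eqP <-|u0].
  rewrite fold_le0// mdist_star0// => h.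
  rewrite (le_trans h)// (le_trans vlo)//.
  by have := exp2V_ge0 (R := R) (dyadic_piece v).+1; lra.
have hu : 0 < u <= 1 by rewrite u0.
have [u01 uhi _] := fold_height_bounds hu.
have := gle (dyadic_piece u) _ (andP u01).1.
have [juv|juv] := eqVneq (dyadic_piece u) (dyadic_piece v).
  move=> _ _; rewrite /fold juv mdist_pt// (le_trans (gle _ _ _))//.
  rewrite /fold_height juv; set j := dyadic_piece v.
  rewrite [X in `|X|](_ : _ = `|2 ^+ j.+2 * v - 3| - `|2 ^+ j.+2 * u - 3|).
    rewrite (@le_trans _ _ (2 ^- j * (2 ^+ j.+2 * (v - u))))//.
      rewrite ler_pM2l ?exp2V_gt0// (le_trans (ler_dist_dist _ _))//.
      rewrite [X in `|X|](_ : _ = 2 ^+ j.+2 * (v - u)); last by ring.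
      by rewrite ger0_norm// mulr_ge0 ?exprn_ge0// subr_ge0 ltW.
    rewrite le_eqVlt; apply/orP; left; apply/eqP.
    transitivity (4 * (2 ^+ j * 2 ^- j) * (v - u)).
      by rewrite !exprS; ring.
    by rewrite exp2V_K mulr1.
  by ring.
have jvu : (dyadic_piece v < dyadic_piece u)%N.
  rewrite ltn_neqAle eq_sym juv -ltnS -exp2V_lt.
  have /andP[h _] := dyadic_pieceP hu; have /andP[_ h'] := dyadic_pieceP hv.
  by rewrite (lt_le_trans h)// (le_trans (ltW uv)).
move=> hgu hgv; rewrite (le_trans (mdist_pt_le _ _ _ _))//.
have : 2 ^- dyadic_piece u <= 2 ^- (dyadic_piece v).+1 :> R by rewrite exp2V_le.
by lra.
Qed.

(** The reversal [1 - x.2] sends the foot to the argument [1], where [fold] is at the foot, and the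
    tip to [0], where the dyadic pieces accumulate. *)
Definition star_map (b : nat -> nat) x : star R :=
  match x.1 with
  | 0 => fold (fun j => 3 * b j + 1)%N (1 - x.2)
  | 1 => fold (fun j => 3 * j + 2)%N (1 - x.2)
  | 2 => star0
  | i.+3 => pt i x.2
  end.

Section StarMap.
Variable b : nat -> nat.
Hypothesis leq_b : forall j, (j <= b j)%N.

Lemma star_map0 : star_map b star0 = star0.
Proof. by rewrite /star_map /= subr0 fold1. Qed.

Lemma star_map_pt i t : 0 <= t <= 1 -> star_map b (pt i t) =
  match i with
  | 0 => fold (fun j => 3 * b j + 1)%N (1 - t)
  | 1 => fold (fun j => 3 * j + 2)%N (1 - t)
  | 2 => star0
  | i'.+3 => pt i' t
  end.
Proof.
move=> /andP[]; rewrite le_eqVlt => /orP[/eqP <- _|t0 t1]; last first.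
  by rewrite /star_map ![star_val _]val_pt ?t0.
rewrite pt0 star_map0 subr0 !fold1.
by case: i => [|[|[|i]]] //; rewrite pt0.
Qed.

Lemma star_map_surj : range (star_map b) = [set: star R].
Proof.
apply/seteqP; split => // y _; have [i [t [ht ->]]] := starP y.
by exists (pt i.+3 t) => //; rewrite star_map_pt.
Qed.

(** The shift expands lengths by exactly [2^3 = 8]; on the arm [1], of length [1/2], the constant
    [4] of [fold] also becomes [8]. *)
Lemma star_map_lipschitz_arm i t s : 0 <= t <= 1 -> 0 <= s <= 1 ->
  mdist (star_map b (pt i t)) (star_map b (pt i s)) <=
  8 * mdist (pt i t) (pt i s).
Proof.
move=> ht hs; have c01 (r : R) : 0 <= r <= 1 -> 0 <= 1 - r <= 1.
  by move=> /andP[r0 r1]; apply/andP; split; lra.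
rewrite (mdist_pt i)// !star_map_pt//.
have ts0 := normr_ge0 (t - s).
case: i => [|[|[|i]]].
- rewrite (le_trans (fold_lipschitz _ (c01 _ ht) (c01 _ hs)))//.
    by move=> j; rewrite (leq_trans (leq_b j))//; lia.
  have -> : 1 - t - (1 - s) = s - t by ring.
  by rewrite (distrC s) expr0 invr1; lra.
- rewrite (le_trans (fold_lipschitz _ (c01 _ ht) (c01 _ hs)))//.
    by move=> j; lia.
  have -> : 1 - t - (1 - s) = s - t by ring.
  by rewrite (distrC s) expr1; lra.
- by rewrite mdistxx !mulr_ge0// exp2V_ge0.
- rewrite mdist_pt// !exprS !invfM.
  by set q := 2 ^- i; rewrite le_eqVlt; apply/orP; left; apply/eqP; field.
Qed.

(** Paths between different arms pass through the foot, which is fixed, so the estimate on single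
    arms adds up. *)
Lemma star_map_continuous : continuous (star_map b).
Proof.
apply: (@lipschitz_continuous_mdist _ _ _ 8) => // x y.
have [i [t [ht ->]]] := starP x; have [j [s [hs ->]]] := starP y.
have [<-|ij] := eqVneq i j; first exact: star_map_lipschitz_arm.
have foot k (r : R) : 0 <= r <= 1 ->
    mdist star0 (star_map b (pt k r)) <= 8 * mdist star0 (pt k r).
  move=> hr; rewrite -{1}star_map0 -(pt0 k).
  by apply: star_map_lipschitz_arm; rewrite // lexx ler01.
rewrite (le_trans (metric_triangle _ star0 _))//.
rewrite mdist_pt_neq// mulrDr -!mdist_star0// metric_sym lerD//; exact: foot.
Qed.

Lemma iter_star_map k a t m : (m <= a)%N -> 0 <= t <= 1 ->
  iter m (star_map b) (pt (3 * a + k) t) = pt (3 * (a - m) + k) t.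
Proof.
move=> + ht; elim: m => [_|m ih ma]; first by rewrite subn0.
rewrite iterS ih ?(ltnW ma)// star_map_pt//.
by have -> : (3 * (a - m) + k = (3 * (a - m.+1) + k).+3)%N by lia.
Qed.

End StarMap.
End FoldingMap.

(** * Separated sets *)

Section SeparatedSets.
Context {R : realType} {X : metricType R}.
Variable f : X -> X.
Implicit Types (n m : nat) (eps : R) (S T U : set X).

(** Diameter at most [eps] in the Bowen metric of order [n]; a separated set meets such a set in at
    most one point. *)
Definition bowen_small n eps U := forall x y, U x -> U y ->
  forall i, (i < n)%N -> mdist (iter i f x) (iter i f y) <= eps.

Definition covered n eps S m := exists (F : finType) (U : F -> set X),
  [/\ (#|F| <= m)%N, S `<=` \bigcup_a U a & forall a, bowen_small n eps (U a)].

Lemma covered_le n eps S m m' : (m <= m')%N ->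
  covered n eps S m -> covered n eps S m'.
Proof.
by move=> mm' [F [U [Fm SU Us]]]; exists F, U; split; rewrite ?(leq_trans Fm).
Qed.

Lemma coveredU n eps S T m m' : covered n eps S m -> covered n eps T m' ->
  covered n eps (S `|` T) (m + m').
Proof.
move=> [F [U [Fm SU Us]]] [F' [U' [Fm' SU' Us']]].
exists (F + F')%type, (fun a => match a with inl a => U a | inr a => U' a end).
split; first by rewrite card_sum leq_add.
  move=> x [/SU|/SU'] [a _ ax]; first by exists (inl a).
  by exists (inr a).
by case.
Qed.

Lemma sep_le_covered n eps m : 0 <= eps ->
  covered n eps [set: X] m -> (sep n eps f <= m%:R%:E)%E.
Proof.
move=> eps0 [F [U [Fm XU Us]]]; apply: ge_ereal_sup => _ [S Ssep <-].
suff SF : (S #<= `I_#|F|)%card.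
  rewrite /counting asboolT; last by apply/finite_set_leP; exists #|F|.
  by rewrite lee_fin ler_nat (leq_trans (geq_card_fset_set SF)).
have [->|/set0P[x0 Sx0]] := eqVneq S set0; first exact: card_ge0.
have [a0 _ _] := XU x0 Logic.I.
(* Pigeonhole: choosing in each piece its only possible point of [S] enumerates all of [S]. *)
pose h k := xget x0 (U (nth a0 (enum F) k) `&` S).
apply: card_le_trans (card_image_le h _); apply: subset_card_le => x Sx.
have [a _ ax] := XU x Logic.I.
exists (enum_rank a) => /=; first exact: ltn_ord.
rewrite /h nth_enum_rank; case: xgetP => [y _ [ay Sy]|/(_ x)]; last by case.
apply: contrapT => yx; have := Ssep _ _ Sy Sx yx.
move/bigmax_gtP => [|[i _]]; first by rewrite ltNge eps0.
by rewrite ltNge (Us a _ _ ay ax).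
Qed.

Lemma sep_ge_card n eps (F : finType) (p : F -> X) : 0 <= eps ->
  (forall a a', a != a' -> exists2 i, (i < n)%N &
    eps < mdist (iter i f (p a)) (iter i f (p a'))) ->
  (#|F|%:R%:E <= sep n eps f)%E.
Proof.
move=> eps0 psep; have pinj : injective p.
  move=> a a' paa'; apply: contrapT => /eqP /psep[i _].
  by rewrite paa' mdistxx ltNge eps0.
have Ssep : separated_set n eps f (range p).
  move=> _ _ [a _ <-] [a' _ <-] aa'.
  have [|i ilt h] := psep a a'; first by apply: contra_notN aa' => /eqP ->.
  by apply/bigmax_gtP; right; exists (Ordinal ilt).
apply: (@le_trans _ _ (counting (range p))); last first.
  by apply: ereal_sup_ubound; exists (range p).
rewrite /counting; case: asboolP => [fin|_]; last by rewrite leey.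
rewrite lee_fin ler_nat leq_card_fset_set//.
have [F0|/card_gt0P[a0 _]] := posnP #|F|.
  by rewrite F0 II0; exact: card_ge0.
pose g x : nat := enum_rank (xget a0 [set a | p a = x]).
apply: card_le_trans (card_image_le g _); apply: subset_card_le => k /= kF.
exists (p (enum_val (Ordinal kF))); first by exists (enum_val (Ordinal kF)).
rewrite /g; case: xgetP => [a _ /= /pinj ->|/(_ (enum_val (Ordinal kF)))[]//].
by rewrite enum_valK.
Qed.

End SeparatedSets.

(** With [x = T * A] and [y = A * J] the left side is [x^2 y + x y + x^2 + 3 x + 3]: nine monomials,
    each at most [x^2 y]. *)
Lemma cover_count T A J : (0 < T)%N -> (0 < A)%N -> (0 < J)%N ->
  ((T * A * (J * A * (T * A * 1).+1).+1).+1 + (T * A * (T * A * 1).+1).+1 +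
   (T * A * 1).+1 <= 9 * T ^ 2 * A ^ 3 * J)%N.
Proof.
move=> T0 A0 J0; have x0 : (0 < T * A)%N by rewrite muln_gt0 T0.
have y0 : (0 < A * J)%N by rewrite muln_gt0 A0.
have -> : (9 * T ^ 2 * A ^ 3 * J = 9 * ((T * A) * (T * A) * (A * J)))%N by ring.
rewrite [(J * A)%N]mulnC muln1; move: (T * A)%N (A * J)%N x0 y0 => x y x0 y0.
have : (x * x <= x * x * y)%N by rewrite leq_pmulr.
have : (x <= x * x)%N by rewrite leq_pmulr.
have : (x * y <= x * x * y)%N by rewrite leq_mul2r leq_pmulr ?orbT.
have -> : (x * (y * x.+1).+1 = x + x * y + x * x * y)%N by ring.
by rewrite (mulnS x x); lia.
Qed.

(** * Counting orbits of the star map by their waiting times *)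

Section StarMapSeparation.
Context {R : realType}.
Implicit Types (x y : star R) (i j k n m : nat) (t s eps : R).
Variable b : nat -> nat.
Local Notation f := (@star_map R b).

(** The points of these arms reach the arm [k] after a wait of [al j] steps. *)
Definition arms (al : nat -> nat) k : set (star R) :=
  [set x | exists j t, 0 <= t <= 1 /\ x = pt (3 * al j + k) t].

(** One stage of the code: a piece records the wait, the height up to [1 / (K + 1)], and the piece
    of [S] entered on leaving the arm [k]. The value [K.+2] counts the grid cells, one of them for
    the tip. *)
Lemma covered_arms n M K eps k al q m (S : set (star R)) :
  K.+1%:R^-1 <= eps -> 2 * 2 ^- M <= eps ->
  (forall j, (al j < n + M)%N -> (j < q)%N) ->
  (forall j t, 0 <= t <= 1 -> S (iter (al j).+1 f (pt (3 * al j + k) t))) ->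
  covered f n eps S m -> covered f n eps (arms al k) (q * K.+2 * m).+1.
Proof.
move=> Keps Meps alq alS [F [U [Fm SU Us]]].
(* The piece [None] holds all waits of at least [n + M]: for [n] steps these points stay on arms of
   index at least [M], hence within [2 * 2^-M] of each other. *)
pose V (c : option ('I_q * 'I_K.+2 * F)) : set (star R) := match c with
  | None => [set x | exists j t,
      [/\ 0 <= t <= 1, x = pt (3 * al j + k) t & (n + M <= al j)%N]]
  | Some (j, c, a) => [set x | exists t, [/\ 0 <= t <= 1,
      c%:R <= K.+1%:R * t <= c.+1%:R, x = pt (3 * al j + k) t
      & U a (iter (al j).+1 f x)]]
  end.
exists (option ('I_q * 'I_K.+2 * F)), V; split.
- by rewrite card_option !card_prod !card_ord ltnS leq_mul2l Fm orbT.
- move=> _ [j [t [ht ->]]].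
  have [jT|jT] := leqP (n + M) (al j); first by exists None => //; exists j, t.
  have [a _ ax] := SU _ (alS j t ht).
  have Kt0 : 0 <= K.+1%:R * t by rewrite mulr_ge0//; case/andP: ht.
  have cK : (Num.truncn (K.+1%:R * t) < K.+2)%N.
    rewrite ltnS truncn_le_nat (@le_lt_trans _ _ K.+1%:R)//.
      by rewrite ler_piMr//; case/andP: ht.
    by rewrite ltr_nat.
  exists (Some (Ordinal (alq _ jT), Ordinal cK, a)) => //=.
  exists t; split => //.
  by have /andP[-> /ltW ->] := truncn_itv Kt0.
move=> [[[j c] a]|] /= x y.
  move=> [t [ht /andP[tl tu] -> ax]] [s [hs /andP[sl su] -> ay]] i ilt.
  (* During the wait both points share an arm and only their heights differ; afterwards the cover of
     [S] takes over. *)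
  have [ij|ij] := leqP i (al j); last first.
    have -> : i = ((i - (al j).+1) + (al j).+1)%N by rewrite subnK.
    by rewrite !iterD; apply: Us ax ay _ _; lia.
  rewrite !iter_star_map// mdist_pt// (le_trans _ Keps)//.
  rewrite (@le_trans _ _ `|t - s|)//; first by rewrite ler_piMl// exp2V_le1.
  rewrite -[leRHS]mul1r ler_pdivlMr// mulrC -[X in X * _]gtr0_norm//.
  rewrite -normrM mulrBr ler_norml; move: tl tu sl su.
  by set A := _ * t; set B := _ * s; rewrite -natr1; lra.
move=> [j [t [ht -> jT]]] [j' [s [hs -> jT']]] i ilt.
rewrite !iter_star_map//; try lia.
have small h (r : R) : (M <= h)%N -> 0 <= r <= 1 -> 2 ^- h * r <= 2 ^- M.
  move=> Mh /andP[r0 r1]; rewrite (@le_trans _ _ (2 ^- h))//.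
    by rewrite ler_piMr// exp2V_ge0.
  by rewrite exp2V_le.
rewrite (le_trans (mdist_pt_le _ _ ht hs))// (le_trans _ Meps)// mulr2n mulrDl.
by rewrite !mul1r lerD// small//; lia.
Qed.

Lemma fold_arm (g : nat -> nat) (u : R) : 0 <= u <= 1 ->
  exists j t, 0 <= t <= 1 /\ fold g u = pt (g j) t.
Proof.
move=> /andP[]; rewrite le_eqVlt => /orP[/eqP <- _|u0 u1].
  by exists 0%N, 0; rewrite fold_le0// pt0 lexx ler01.
exists (dyadic_piece u), (fold_height u); split => //.
by have [|] := @fold_height_bounds R u; rewrite ?u0.
Qed.

(** The stages are composed backwards from the foot, each cover serving as the target of the
    preceding stage. *)
Lemma star_covered n M K eps J :
  K.+1%:R^-1 <= eps -> 2 * 2 ^- M <= eps ->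
  (forall j, (b j < n + M)%N -> (j < J)%N) -> (0 < n)%N -> (0 < J)%N ->
  covered f n eps [set: star R] (9 * (n + M) ^ 2 * K.+2 ^ 3 * J).
Proof.
move=> Keps Meps bJ n0 J0; set T := (n + M)%N in bJ *; set A := K.+2.
have T0 : (0 < T)%N by rewrite /T; lia.
have one (r : R) : 0 <= r <= 1 -> 0 <= 1 - r <= 1.
  by move=> /andP[r0 r1]; apply/andP; split; lra.
have c3 : covered f n eps [set star0] 1.
  exists unit, (fun=> [set star0]); split; first by rewrite card_unit.
    by move=> x; exists tt.
  move=> _ _ _ -> -> i _; rewrite mdistxx (le_trans _ Keps)//.
have step al k j t : 0 <= t <= 1 -> iter (al j).+1 f (pt (3 * al j + k) t) =
    f (pt k t).
  by move=> ht; rewrite iterS iter_star_map// subnn.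
have c2 : covered f n eps (arms id 2) (T * A * 1).+1.
  apply: (covered_arms Keps Meps _ _ c3) => // j t ht.
  by rewrite (step id)// star_map_pt.
have into2 al j t : 0 <= t <= 1 ->
    arms id 2 (iter (al j).+1 f (pt (3 * al j + 1) t)).
  move=> ht; rewrite step// star_map_pt//.
  have [j' [s [hs ->]]] := fold_arm (fun j => 3 * j + 2)%N (one _ ht).
  by exists j', s.
have c1 : covered f n eps (arms id 1) (T * A * (T * A * 1).+1).+1.
  by apply: (covered_arms Keps Meps _ _ c2) => // j t ht; exact: (into2 id).
(* After a fold of the arm [0] only the waits [b j] occur, so [J] replaces a factor [T]. The full
   family [arms id 1] is still needed for orbits that start there. *)
have c1' : covered f n eps (arms b 1) (J * A * (T * A * 1).+1).+1.
  by apply: (covered_arms Keps Meps _ _ c2) => // j t ht; exact: into2.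
have c0 : covered f n eps (arms id 0) (T * A * (J * A * (T * A * 1).+1).+1).+1.
  apply: (covered_arms Keps Meps _ _ c1') => // j t ht.
  rewrite (step id)// star_map_pt//.
  have [j' [s [hs ->]]] := fold_arm (fun j => 3 * b j + 1)%N (one _ ht).
  by exists j', s.
have DE : [set: star R] = (arms id 0 `|` arms id 1) `|` arms id 2.
  apply/seteqP; split => // x _; have [i [t [ht ->]]] := starP x.
  have [k k3 ->] : exists2 k, (k < 3)%N & i = (3 * (i %/ 3) + k)%N.
    by exists (i %% 3)%N; rewrite ?ltn_mod// {1}(divn_eq i 3) mulnC.
  case: k k3 => [|[|[|//]]] _; [left; left|left; right|right];
    by exists (i %/ 3)%N, t.
rewrite DE; apply: covered_le (coveredU (coveredU c0 c1) c2).
exact: cover_count.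
Qed.

(** From [fold_hit] with [t = 1]: the height on the arm [1] that is sent to the tip of the arm
    [3 c + 2]. Likewise [start_height] is the height on the arm [0] that is sent to [visit_height c]
    on the arm [3 b_j + 1]. *)
Definition visit_height c : R := 1 - 3 * 2 ^- c.+2.

Definition start_height j c : R := 1 - (2 + visit_height c) * 2 ^- j.+2.

(* The point that spends [a] steps on its way to the arm [0], then [b j] steps
   to the arm [1], then [c] steps to the tip of the arm [2]. *)
Definition visitor a j c : star R := pt (3 * a + 0) (start_height j c).

Lemma exp2V_quarter i : 0 < (2 ^- i.+2 : R) <= 4^-1.
Proof.
rewrite exp2V_gt0 !exprS !invfM; have := exp2V_le1 (R := R) i.
by set q := 2 ^- i => q1; lra.
Qed.

Lemma visit_height_itv c : 4^-1 <= visit_height c <= 1.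
Proof.
rewrite /visit_height; have /andP[] := exp2V_quarter c.
by move=> h0 h1; apply/andP; split; lra.
Qed.

Lemma start_height_itv j c : 4^-1 <= start_height j c <= 1.
Proof.
rewrite /start_height; have /andP[] := exp2V_quarter j.
have /andP[] := visit_height_itv c; set q := 2 ^- j.+2; set h := visit_height c.
by move=> h0 h1 q0 q1; apply/andP; split; nra.
Qed.

Lemma quarter_itv t : 4^-1 <= t <= 1 -> 0 <= t <= 1.
Proof. by move=> /andP[t0 ->]; rewrite (le_trans _ t0). Qed.

Lemma iter_visitor0 a j c m : (m <= a)%N ->
  iter m f (visitor a j c) = pt (3 * (a - m) + 0) (start_height j c).
Proof.
move=> ma; rewrite /visitor iter_star_map//.
exact/quarter_itv/start_height_itv.
Qed.

Lemma iter_visitor1 a j c m : (m <= b j)%N ->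
  iter (m + a.+1) f (visitor a j c) = pt (3 * (b j - m) + 1) (visit_height c).
Proof.
move=> mb; rewrite iterD iterS iter_visitor0// subnn star_map_pt; last first.
  exact/quarter_itv/start_height_itv.
have /andP[h0 h1] := visit_height_itv c.
rewrite /start_height subKr fold_hit; last by rewrite h1 (lt_le_trans _ h0).
by rewrite iter_star_map// (quarter_itv (visit_height_itv c)).
Qed.

Lemma iter_visitor2 a j c m : (m <= c)%N ->
  iter (m + ((b j).+1 + a.+1)) f (visitor a j c) = pt (3 * (c - m) + 2) 1.
Proof.
move=> mc; rewrite iterD addSn iterS iter_visitor1// subnn.
rewrite star_map_pt; last first.
  exact/quarter_itv/visit_height_itv.
have -> : 1 - visit_height c = (2 + 1) * 2 ^- c.+2.
  by rewrite /visit_height; ring.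
have -> : fold (fun j => 3 * j + 2)%N ((2 + 1) * 2 ^- c.+2) =
    pt (3 * c + 2) 1 :> star R.
  by apply: fold_hit; rewrite ltr01 lexx.
by rewrite iter_star_map ?ler01 ?lexx.
Qed.

(** The constant is [1/4 * 1/4]: the least length among the arms [0], [1], [2] times the least
    height of a visitor. *)
Lemma mdist_pt_far i i' t s : (i < 3)%N -> i != i' ->
  4^-1 <= t <= 1 -> 0 <= s <= 1 -> 16^-1 <= mdist (pt i t) (pt i' s).
Proof.
move=> i3 ii' ht hs; rewrite mdist_pt_neq ?(quarter_itv ht)//.
have i2 : 2 ^- 2 <= 2 ^- i :> R by rewrite exp2V_le.
have : 0 <= 2 ^- i' * s by rewrite mulr_ge0 ?exp2V_ge0//; case/andP: hs.
move: i2; case/andP: ht => t0 _; set q := 2 ^- i; set r := _ * s.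
by rewrite expr2 => q0 r0; nra.
Qed.

(** At the end of the first wait that differs, the visitor with the shorter wait is on one of the
    arms [0], [1], [2], while the other is still on a higher arm of the same residue. *)
Lemma visitor_far a j c a' j' c' :
  [|| (a < a')%N, (a == a') && (b j < b j')%N
    | [&& a == a', j == j' & (c < c')%N]] ->
  exists2 i, (i <= a + b j + c + 2)%N &
    16^-1 <= mdist (iter i f (visitor a j c)) (iter i f (visitor a' j' c')).
Proof.
move=> /or3P[aa|/andP[/eqP <- jj]|/and3P[/eqP <- /eqP <- cc]].
- exists a; first by lia.
  rewrite !iter_visitor0 ?(ltnW aa)//; apply: mdist_pt_far; try lia.
    exact: start_height_itv.
  exact/quarter_itv/start_height_itv.
- exists (b j + a.+1)%N; first by lia.
  rewrite !iter_visitor1 ?(ltnW jj)//; apply: mdist_pt_far; try lia.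
    exact: visit_height_itv.
  exact/quarter_itv/visit_height_itv.
- exists (c + ((b j).+1 + a.+1))%N; first by lia.
  rewrite !iter_visitor2 ?(ltnW cc)//; apply: mdist_pt_far; try lia.
    by apply/andP; split; lra.
  by rewrite ler01 lexx.
Qed.

Lemma star_sep_ge n N J eps : injective b ->
  (forall j, (j < J)%N -> (b j <= N)%N) -> (3 * N + 3 <= n)%N ->
  0 <= eps < 16^-1 -> ((N.+1 * J * N.+1)%:R%:E <= sep n eps f)%E.
Proof.
move=> binj bN Nn /andP[eps0 eps16].
pose p (x : 'I_N.+1 * 'I_J * 'I_N.+1) := visitor x.1.1 x.1.2 x.2.
have -> : (N.+1 * J * N.+1)%N = #|{: 'I_N.+1 * 'I_J * 'I_N.+1}|.
  by rewrite !card_prod !card_ord.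
apply: (@sep_ge_card _ _ _ _ _ _ p) => // -[[a j] c] [[a' j'] c'] neq.
(* Distinct codes are comparable in the lexicographic order of the waits, by injectivity of [b], and
   the distance is symmetric. *)
wlog lt : a j c a' j' c' neq /
    [|| (a < a')%N, (a == a' :> nat) && (b j < b j')%N
    | [&& a == a' :> nat, j == j' :> nat & (c < c')%N]].
  move=> hw; have [] := ltngtP a a' => aa.
  - by apply: hw => //; rewrite aa.
  - rewrite eq_sym in neq; have [|i ilt far] := hw _ _ _ _ _ _ neq.
      by rewrite aa.
    by exists i => //; rewrite metric_sym.
  have [] := ltngtP (b j) (b j') => jj.
  - by apply: hw => //; rewrite aa eqxx jj orbT.
  - rewrite eq_sym in neq; have [|i ilt far] := hw _ _ _ _ _ _ neq.
      by rewrite aa eqxx jj orbT.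
    by exists i => //; rewrite metric_sym.
  have {}jj := binj _ _ jj; have [] := ltngtP c c' => cc.
  - by apply: hw => //; rewrite aa jj !eqxx cc !orbT.
  - rewrite eq_sym in neq; have [|i ilt far] := hw _ _ _ _ _ _ neq.
      by rewrite aa jj !eqxx cc !orbT.
    by exists i => //; rewrite metric_sym.
  by move: neq; rewrite (val_inj aa) (val_inj jj) (val_inj cc) eqxx.
have [i ile far] := visitor_far lt; exists i; last exact: lt_le_trans far.
have := bN _ (ltn_ord j); have := ltn_ord a; have := ltn_ord c.
by move: ile; rewrite /=; lia.
Qed.

End StarMapSeparation.

(** * Growth rates *)

Section Growth.
Context {R : realType}.
Implicit Types (c C alpha beta : R) (n j : nat).

Lemma cvg_div_ln c : c / ln n%:R @[n --> \oo] --> (0 : R).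
Proof.
apply/cvgrPdist_lt => e e0.
exists (Num.truncn (expR (`|c| / e))).+2 => // n /= hn.
have : expR (`|c| / e) < n%:R.
  by rewrite (lt_le_trans (truncnS_gt _))// ler_nat ltnW.
have n0 : 0 < n%:R :> R by rewrite ltr0n (leq_trans _ hn).
rewrite -{1}[n%:R]lnK ?posrE// ltr_expR => h.
have ln0 : 0 < ln n%:R :> R by rewrite (le_lt_trans _ h)// divr_ge0// ltW.
rewrite sub0r normrN normrM normfV (gtr0_norm ln0) ltr_pdivrMr//.
by rewrite mulrC -ltr_pdivrMr.
Qed.

(** Multiplicative constants vanish: [ln (k * n^alpha) / ln n = alpha + ln k / ln n]. *)
Lemma limn_esup_power_growth (s : nat -> \bar R) alpha c C n0 :
  0 < c -> 0 < C ->
  (forall n, (n0 <= n)%N ->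
    ((c * n%:R `^ alpha)%:E <= s n <= (C * n%:R `^ alpha)%:E)%E) ->
  limn_esup (fun n => (lne (s n) / (ln n%:R)%:E)%E) = alpha%:E.
Proof.
move=> c0 C0 hs.
have cvgK k : ((alpha + k / ln n%:R)%:E)%E @[n --> \oo] --> alpha%:E.
  apply: cvg_EFin; first by apply: nearW.
  rewrite -[X in _ --> X]addr0; apply: cvgD; first exact: cvg_cst.
  exact: cvg_div_ln.
suff h : (lne (s n) / (ln n%:R)%:E)%E @[n --> \oo] --> alpha%:E.
  by have [_ ->] := cvg_limn_einf_sup h.
apply: squeeze_cvge (cvgK (ln c)) (cvgK (ln C)).
exists (maxn n0 2) => // n /=; rewrite geq_max => /andP[n0n n2].
have n_gt0 : 0 < n%:R :> R by rewrite ltr0n; lia.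
have na0 : 0 < n%:R `^ alpha by exact: powR_gt0.
have lnn : 0 < ln n%:R :> R by rewrite ln_gt0// ltr1n.
have /andP[] := hs _ n0n.
case: (s n) => [r| |]; rewrite ?leeNy_eq ?leye_eq// !lee_fin => lo hi.
have r0 : 0 < r by rewrite (lt_le_trans _ lo)// mulr_gt0.
rewrite lne_EFin// inver gt_eqF// -EFinM !lee_fin.
have e k : 0 < k -> alpha + ln k / ln n%:R = ln (k * n%:R `^ alpha) / ln n%:R.
  by move=> k0; rewrite lnM ?posrE// ln_powR; field; rewrite gt_eqF.
by rewrite !e// !ler_pM2r ?invr_gt0// !ler_ln ?posrE ?mulr_gt0// lo.
Qed.

(** A rounded inverse of [T |-> T^beta], so that about [T^beta] of its values lie below [T]. *)
Definition sparse beta j : nat := Num.truncn (j%:R `^ beta^-1 : R).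

Lemma sparse_ge beta j : 0 < beta <= 1 -> (j <= sparse beta j)%N.
Proof.
move=> /andP[b0 b1]; rewrite /sparse truncn_ge_nat ?powR_ge0//.
by case: j => [|j]; rewrite ?powR_ge0// le1r_powR ?ler1n// invf_ge1.
Qed.

Lemma sparse_ltS beta j : 0 < beta <= 1 -> (sparse beta j < sparse beta j.+1)%N.
Proof.
move=> /andP[b0 b1]; set p := beta^-1.
have p1 : 1 <= p by rewrite invf_ge1.
have p0 : 0 < p by rewrite invr_gt0.
rewrite /sparse -/p truncn_gt_nat -natr1.
have h : j%:R `^ p + 1 <= j.+1%:R `^ p.
  (* Splitting off one factor shows that [x^p] with [p >= 1] grows by at least [1] between
     consecutive integers; so rounding down merges no values. *)
  have E (x : R) : 0 <= x -> x `^ p = x * x `^ (p - 1).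
    by move=> x0; rewrite mulr_powRB1.
  rewrite (E j%:R)// (E j.+1%:R)// -(natr1 j) mulrDl mul1r lerD//.
    apply: ler_wpM2l => //; apply: ge0_ler_powR;
      by rewrite ?nnegrE ?subr_ge0 ?addr_ge0 ?lerDl.
  have {1}-> : 1 = 1 `^ (p - 1) :> R by rewrite powR1.
  apply: ge0_ler_powR;
    by rewrite ?nnegrE ?subr_ge0 ?addr_ge0 ?lerDr.
by rewrite (le_trans _ h)// lerD2r truncn_le ?powR_ge0.
Qed.

Lemma sparse_inj beta : 0 < beta <= 1 -> injective (sparse beta).
Proof.
move=> hb; have mono : {homo sparse beta : i j / (i < j)%N}.
  by apply: homo_ltn => [|j]; [exact: ltn_trans|exact: sparse_ltS].
by move=> i j ij; have [/mono|/mono|//] := ltngtP i j; rewrite ij ltnn.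
Qed.

Lemma sparse_lt beta T j : 0 < beta -> (sparse beta j < T)%N ->
  (j < (Num.truncn (T%:R `^ beta : R)).+1)%N.
Proof.
move=> b0; rewrite /sparse truncn_lt_nat ?powR_ge0// => h.
rewrite ltnS truncn_ge_nat ?powR_ge0// ltW//.
have := gt0_ltr_powR b0 _ _ h; rewrite -powRrM mulVf ?gt_eqF// powRr1//.
by apply; rewrite nnegrE ?powR_ge0.
Qed.

Lemma sparse_le beta N j : 0 < beta ->
  (j < (Num.truncn (N%:R `^ beta : R)).+1)%N -> (sparse beta j <= N)%N.
Proof.
move=> b0; rewrite ltnS truncn_ge_nat ?powR_ge0// => h.
rewrite /sparse truncn_le_nat (@le_lt_trans _ _ N%:R) ?ltr_nat//.
have bi0 : 0 <= beta^-1 by rewrite invr_ge0 ltW.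
have := ge0_ler_powR bi0 _ _ h; rewrite -powRrM mulfV ?gt_eqF// powRr1//.
by apply; rewrite nnegrE ?powR_ge0.
Qed.

End Growth.

(** * Entropy of the star map *)

Section StarMapEntropy.
Context {R : realType}.
Variable alpha : R.
Hypothesis alpha23 : 2 < alpha < 3.
Local Notation b := (@sparse R (alpha - 2)).
Local Notation f := (@star_map R b).

Lemma beta01 : 0 < alpha - 2 <= 1.
Proof. by case/andP: alpha23 => h1 h2; apply/andP; split; lra. Qed.

Lemma powR_split (T : nat) : (0 < T)%N ->
  T%:R `^ alpha = T%:R ^+ 2 * T%:R `^ (alpha - 2) :> R.
Proof.
move=> T0; rewrite -powR_mulrn// -powRD; first by congr powR; ring.
by apply/implyP => _; rewrite pnatr_eq0; lia.
Qed.

Lemma star_sep_upper (eps : R) : 0 < eps -> exists2 C : R, 0 < C &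
  forall n, (0 < n)%N -> (sep n eps f <= (C * n%:R `^ alpha)%:E)%E.
Proof.
move=> eps0; have /andP[bt0 bt1] := beta01.
have a0 : 0 <= alpha by lra.
have [K Keps] : exists K, K.+1%:R^-1 <= eps.
  exists (Num.truncn eps^-1); rewrite -[leRHS]invrK lef_pV2 ?posrE ?invr_gt0//.
  exact/ltW/truncnS_gt.
have [M /(_ _ (leqnn _)) Meps] : exists M,
    forall i, (M <= i)%N -> 2 ^- i < eps / 2.
  by apply: exp2V_cvg0; rewrite divr_gt0.
have {}Meps : 2 * 2 ^- M <= eps by lra.
(* The [9] of [star_covered] is doubled by [J <= 2 T^(alpha - 2)], and the last factor comes from
   [n + M <= (M + 1) n]. *)
exists (18 * K.+2%:R ^+ 3 * M.+1%:R `^ alpha).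
  by rewrite !mulr_gt0 ?exprn_gt0 ?powR_gt0.
move=> n n0; set T := (n + M)%N.
set J := (Num.truncn (T%:R `^ (alpha - 2) : R)).+1.
have T0 : (0 < T)%N by rewrite /T; lia.
have /(sep_le_covered (ltW eps0)) h : covered f n eps [set: star R]
    (9 * (n + M) ^ 2 * K.+2 ^ 3 * J).
  apply: (star_covered Keps Meps) => // j.
  exact: sparse_lt.
rewrite (le_trans h)// lee_fin -/T.
have T1 : 1 <= T%:R `^ (alpha - 2) :> R.
  have {1}-> : 1 = 1 `^ (alpha - 2) :> R by rewrite powR1.
  by apply: ge0_ler_powR; rewrite ?nnegrE ?ler1n// ltW.
have JT : J%:R <= 2 * T%:R `^ (alpha - 2) :> R.
  have : (Num.truncn (T%:R `^ (alpha - 2) : R))%:R <= T%:R `^ (alpha - 2) :> R.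
    by rewrite truncn_le ?powR_ge0.
  by rewrite /J -natr1; lra.
have Tn : T%:R `^ alpha <= M.+1%:R `^ alpha * n%:R `^ alpha :> R.
  rewrite -powRM// ge0_ler_powR ?nnegrE// -natrM ler_nat /T; nia.
have -> : (9 * T ^ 2 * K.+2 ^ 3 * J)%:R =
    9 * T%:R ^+ 2 * K.+2%:R ^+ 3 * J%:R :> R by rewrite !natrM; ring.
apply: (@le_trans _ _
  (9 * T%:R ^+ 2 * K.+2%:R ^+ 3 * (2 * T%:R `^ (alpha - 2)))).
  by rewrite ler_wpM2l// !mulr_ge0 ?exprn_ge0.
have -> : 9 * T%:R ^+ 2 * K.+2%:R ^+ 3 * (2 * T%:R `^ (alpha - 2)) =
    18 * K.+2%:R ^+ 3 * T%:R `^ alpha by rewrite powR_split//; ring.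
by rewrite -!mulrA !ler_pM2l ?exprn_gt0.
Qed.

Lemma star_sep_lower n (eps : R) : (9 <= n)%N -> 0 <= eps < 16^-1 ->
  ((6^-1 `^ alpha * n%:R `^ alpha)%:E <= sep n eps f)%E.
Proof.
move=> n9 heps; have /andP[bt0 bt1] := beta01.
have a0 : 0 <= alpha by lra.
(* [N] is the largest bound on the waits with [3 N + 3 <= n]; from [n = 9] on, it satisfies
   [n <= 6 N], whence the constant [6^-1]. *)
pose N := (n %/ 3).-1; pose J := (Num.truncn (N%:R `^ (alpha - 2) : R)).+1.
have N0 : (0 < N)%N by rewrite /N; lia.
have nN : (n <= 6 * N)%N by rewrite /N; lia.
apply: le_trans (star_sep_ge (N := N) (J := J) _ _ _ heps).
- rewrite lee_fin -powRM//.
  apply: (@le_trans _ _ (N%:R `^ alpha)).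
    rewrite ge0_ler_powR ?nnegrE// ?mulr_ge0// mulrC ler_pdivrMr//.
    by rewrite -natrM ler_nat mulnC.
  have -> : (N.+1 * J * N.+1)%:R = N.+1%:R ^+ 2 * J%:R :> R.
    by rewrite !natrM; ring.
  rewrite powR_split//; apply: ler_pM; rewrite ?powR_ge0 ?exprn_ge0//.
    by rewrite lerXn2r ?nnegrE// ler_nat.
  exact/ltW/truncnS_gt.
- exact: sparse_inj beta01.
- by move=> j; exact: sparse_le.
- by rewrite /N; lia.
Qed.

(** For every [eps] below [1/16] the growth rate is already [alpha]: only the upper constant depends
    on [eps], and it disappears in the limit over [n]. *)
Lemma hpol_star_map : hpol f = alpha%:E.
Proof.
apply: lim_near_cst; first exact: ereal_hausdorff.
exists 16^-1 => //= eps /=; rewrite sub0r normrN => heps eps0.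
have [C C0 upper] := star_sep_upper eps0.
apply: (@limn_esup_power_growth _ _ _ (6^-1 `^ alpha) C 9) => // n n9.
rewrite upper ?andbT; last by lia.
apply: star_sep_lower => //; rewrite ltW//=.
by rewrite (le_lt_trans _ heps)// ler_norm.
Qed.

End StarMapEntropy.

Theorem theorem41 (R : realType) (alpha : R) (halpha : 2 < alpha < 3) :
  exists (D : metricType R) (f : D -> D),
    [/\ dendrite D, continuous f, range f = [set: D] & hpol f = alpha%:E].
Proof.
have leq_b j : (j <= sparse (alpha - 2) j)%N by exact/sparse_ge/beta01.
exists (star R), (star_map (sparse (alpha - 2))); split.
- exact: star_dendrite.
- exact: star_map_continuous.
- exact: star_map_surj.
- exact: hpol_star_map.
Qed.
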